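(* Let $Q(\cdot,/,\backslash)$ be a generalized Moufang loop with respect to a mapping $\alpha$ of $Q$ onto itself, with the $\alpha$-elasticity identity $(y\cdot z)\cdot y^{\alpha}=y\cdot(z\cdot y^{\alpha})$. Then this identity is universal for $Q$ if and only if the following two conditions are satisfied for all $x,y,z,b\in Q$: $$((y\cdot z)/x)\cdot\big(b\backslash (y^{\alpha}\cdot x)\big)= y\cdot\Big(b\backslash\big[((b\cdot z)/x)\cdot(b\backslash (y^{\alpha}\cdot x))\big]\Big)$$ and $$\Big(\big[((b\cdot y)/x)\cdot(b\backslash (z\cdot x))\big]/x\Big)\cdot y^{\alpha}= ((b\cdot y)/x)\cdot\big(b\backslash (z\cdot y^{\alpha})\big).$$
   Context: A loop $(Q,\cdot)$ is a quasigroup with a two-sided identity element; $b\backslash a$ denotes the unique $u$ with $b\cdot u=a$, and $a/b$ the unique $v$ with $v\cdot b=a$. For a mapping $\alpha$ of $Q$ onto itself, $y^{\alpha}$ denotes the image of $y$ under $\alpha$. A loop $Q$ is a generalized Moufang loop (with respect to $\alpha$) if $((x\cdot y)\cdot z)\cdot y^{\alpha}=x\cdot(y\cdot(z\cdot y^{\alpha}))$ for all $x,y,z\in Q$. The $\alpha$-elasticity identity is $(y\cdot z)\cdot y^{\alpha}=y\cdot(z\cdot y^{\alpha})$ for all $y,z\in Q$. The principal isotopes of $(Q,\cdot)$ are the loops $(Q,\circ)$ with $x\circ y=(x/a)\cdot(b\backslash y)$, for $a,b\in Q$. An identity is universal for a loop if it holds in the loop and in each of its principal isotopes; here $\alpha$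 is the same map on the set $Q$ for all isotopes, so universality of $\alpha$-elasticity means that $(y\circ z)\circ y^{\alpha}=y\circ(z\circ y^{\alpha})$ for all $y,z\in Q$ and every principal isotope $(Q,\circ)$. *)

(* Defs.v *)
(* Loops in equational form: the four division axioms say exactly that
   [rdiv a b] (resp. [ldiv b a]) is the unique solution v of v * b = a
   (resp. u of b * u = a); see [rdivP] and [ldivP]. *)
Record loop : Type := Loop {
  carrier :> Type;
  mul : carrier -> carrier -> carrier;
  rdiv : carrier -> carrier -> carrier;
  ldiv : carrier -> carrier -> carrier;
  one : carrier;
  rdivK : forall a b, mul (rdiv a b) b = a;
  mulrK : forall a b, rdiv (mul a b) b = a;
  ldivK : forall b a, mul b (ldiv b a) = a;
  mullK : forall b a, ldiv b (mul b a) = a;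
  mul1x : forall x, mul one x = x;
  mulx1 : forall x, mul x one = x
}.

Arguments mul {l} _ _.
Arguments rdiv {l} _ _.
Arguments ldiv {l} _ _.
Arguments one {l}.

Declare Scope loop_scope.
Delimit Scope loop_scope with loop.
Notation "x * y" := (mul x y) : loop_scope.
Notation "a / b" := (rdiv a b) : loop_scope.
Notation "b \ a" := (ldiv b a) (at level 40, left associativity) : loop_scope.
Local Open Scope loop_scope.

Lemma rdivP (Q : loop) (a b v : Q) : v * b = a <-> v = a / b.
Proof. split; intros H; subst; [now rewrite mulrK | apply rdivK]. Qed.

Lemma ldivP (Q : loop) (a b u : Q) : b * u = a <-> u = b \ a.
Proof. split; intros H; subst; [now rewrite mullK | apply ldivK]. Qed.

(* The principal isotope x o y = (x / a) * (b \ y); its identity is b * a. *)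
Section Isotope.
Variables (Q : loop) (a b : Q).

Definition iso_mul (x y : Q) : Q := (x / a) * (b \ y).
Definition iso_rdiv (x y : Q) : Q := (x / (b \ y)) * a.
Definition iso_ldiv (y x : Q) : Q := b * ((y / a) \ x).

Lemma iso_rdivK x y : iso_mul (iso_rdiv x y) y = x.
Proof. unfold iso_mul, iso_rdiv; now rewrite mulrK, rdivK. Qed.

Lemma iso_mulrK x y : iso_rdiv (iso_mul x y) y = x.
Proof. unfold iso_mul, iso_rdiv; now rewrite mulrK, rdivK. Qed.

Lemma iso_ldivK y x : iso_mul y (iso_ldiv y x) = x.
Proof. unfold iso_mul, iso_ldiv; now rewrite mullK, ldivK. Qed.

Lemma iso_mullK y x : iso_ldiv y (iso_mul y x) = x.
Proof. unfold iso_mul, iso_ldiv; now rewrite mullK, ldivK. Qed.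

Lemma iso_mul1x x : iso_mul (b * a) x = x.
Proof. unfold iso_mul; now rewrite mulrK, ldivK. Qed.

Lemma iso_mulx1 x : iso_mul x (b * a) = x.
Proof. unfold iso_mul; now rewrite mullK, rdivK. Qed.

Definition isotope : loop :=
  {| carrier := Q; mul := iso_mul; rdiv := iso_rdiv; ldiv := iso_ldiv;
     one := b * a; rdivK := iso_rdivK; mulrK := iso_mulrK;
     ldivK := iso_ldivK; mullK := iso_mullK;
     mul1x := iso_mul1x; mulx1 := iso_mulx1 |}.

End Isotope.

Definition generalized_moufang (Q : loop) (alpha : Q -> Q) : Prop :=
  forall x y z : Q, ((x * y) * z) * alpha y = x * (y * (z * alpha y)).

Definition alpha_elastic (Q : loop) (alpha : Q -> Q) : Prop :=
  forall y z : Q, (y * z) * alpha y = y * (z * alpha y).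

(* The isotopes have the same carrier as Q, so [alpha] is the same map on the
   underlying set for Q and for all of them. *)
Definition universal (P : forall Q : loop, (Q -> Q) -> Prop)
    (Q : loop) (alpha : Q -> Q) : Prop :=
  P Q alpha /\ forall a b : Q, P (isotope Q a b) alpha.

(* Main.v *)
Require Import Defs.
From Stdlib Require Import FinFun.
Local Open Scope loop_scope.

(** Both sides of the equivalence hold outright, because the hypotheses already
    force [Q] to be a Moufang loop in which [alpha y] differs from [y] by an
    element of the nucleus.

    Put c = alpha y.  The generalized Moufang identity and elasticity together
    give the inverse property ([generalized_moufang_inverse_property]), and
    inverses turn the generalized Moufang identity into
    (y p)(q c) = (y (p q)) c: the triple (L_y, R_c, R_c L_y) is an autotopism
    ([alpha_companion]).  It carries the identity element to y in its first
    coordinate.  Since y is arbitrary, transporting the left inverse property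
    along these autotopisms yields the left Bol identity
    ([companion_left_bol]), and inversion then yields the right one.

    A Moufang loop has the autotopisms (L_y, R_y, R_y L_y) as well.  Two
    autotopisms with first coordinate L_y have quotient (id, R_n, R_n) with n
    in the nucleus ([companion_quotient_nuclear]), so alpha y = y n.  The same
    comparison shows that the nucleus is normal, so alpha y * x = (y x) n' with
    n' in the nucleus ([alpha_mul_nuclear]).

    Both Bol identities pass to principal isotopes, hence so does ordinary
    elasticity.  Written in terms of the multiplication of [Q], elasticity of
    an isotope survives multiplying the second occurrence of the repeated
    element by a nuclear element ([twisted_isotope_elastic]).  Elasticity of the
    isotopes for [alpha] and the two displayed conditions are three
    substitution instances of that single identity. *)

(** * Bol identities, elasticity and isotopes *)

Lemma mul_cancel_r (Q : loop) (a u v : Q) : u * a = v * a -> u = v.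
Proof. intros H; now rewrite <- (mulrK Q u a), H, mulrK. Qed.

Lemma mul_cancel_l (Q : loop) (a u v : Q) : a * u = a * v -> u = v.
Proof. intros H; now rewrite <- (mullK Q a u), H, mullK. Qed.

Definition opposite (Q : loop) : loop :=
  {| carrier := Q; mul := fun x y => y * x;
     rdiv := fun a b => b \ a; ldiv := fun b a => a / b; one := one;
     rdivK := fun a b => ldivK Q b a; mulrK := fun a b => mullK Q b a;
     ldivK := fun b a => rdivK Q a b; mullK := fun b a => mulrK Q a b;
     mul1x := mulx1 Q; mulx1 := mul1x Q |}.

Definition left_bol (Q : loop) : Prop :=
  forall x y z : Q, (x * (y * x)) * z = x * (y * (x * z)).

(** Oriented so as to be convertible with [left_bol (opposite Q)]. *)
Definition right_bol (Q : loop) : Prop :=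
  forall x y z : Q, z * ((x * y) * x) = ((z * x) * y) * x.

Definition inv {Q : loop} (x : Q) : Q := one / x.

Definition left_inverse_property (Q : loop) : Prop :=
  forall x y : Q, inv x * (x * y) = y.

Lemma left_inverse_property_ldiv (Q : loop) :
  left_inverse_property Q -> forall b z : Q, b \ z = inv b * z.
Proof. intros lip b z; now rewrite <- (lip b (b \ z)), ldivK. Qed.

(** Take the inverse of x for y in the Bol identity and cancel x. *)
Lemma left_bol_inverse_property (Q : loop) :
  left_bol Q -> left_inverse_property Q.
Proof.
  intros bol x z. pose proof (bol x (inv x) z) as E.
  unfold inv in *. rewrite rdivK, mulx1 in E.
  symmetry; exact (mul_cancel_l _ _ _ _ E).
Qed.

(** Applying both sides of the left Bol identity to the inverse of x gives
    (x (y x)) x^-1 = x y, and the right inverse property, which comes from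
    the right Bol identity, moves x^-1 to the other side. *)
Lemma bol_elastic (Q : loop) :
  left_bol Q -> right_bol Q -> forall x y : Q, (x * y) * x = x * (y * x).
Proof.
  intros lb rb x y. apply (mul_cancel_r _ (x \ one)).
  rewrite lb, ldivK, mulx1.
  exact (left_bol_inverse_property (opposite Q) rb x (x * y)).
Qed.

(** The left translations of the isotope are the maps L_u L_b^-1, and the left
    Bol identity says that the set of maps L_u is closed under f g f; the map
    L_b^-1 L_v L_b^-1 is itself a left translation since L_b^-1 is one. *)
Lemma isotope_left_bol (Q : loop) (a b : Q) :
  left_bol Q -> left_bol (isotope Q a b).
Proof.
  intros bol x y z; cbn in x, y, z |- *; unfold iso_mul.
  pose proof (left_inverse_property_ldiv Q (left_bol_inverse_property Q bol))
    as ldivE.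
  rewrite (ldivE b x), (ldivE b z).
  set (u := x / a). set (v := y / a).
  replace x with (u * a) by apply rdivK.
  rewrite !(ldivE b).
  rewrite <- (bol (inv b) v (u * a)), <- (bol (inv b) v (u * _)).
  rewrite <- !(bol u), mulrK. reflexivity.
Qed.

(** Taking the opposite loop exchanges the two parameters of the isotope. *)
Lemma isotope_right_bol (Q : loop) (a b : Q) :
  right_bol Q -> right_bol (isotope Q a b).
Proof. exact (isotope_left_bol (opposite Q) b a). Qed.

Definition right_nuclear {Q : loop} (n : Q) : Prop :=
  forall p q : Q, (p * q) * n = p * (q * n).

Lemma right_nuclear_ldiv (Q : loop) (n : Q) :
  right_nuclear n -> forall b q : Q, b \ (q * n) = (b \ q) * n.
Proof. intros nuc b q; symmetry; apply (proj1 (ldivP Q _ _ _)); now rewrite <- nuc, ldivK. Qed.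

(** For n the identity element this is elasticity of the isotope at the
    elements u a and b v.  A nuclear n can be pulled out to the far right of
    both sides, so the general case is that equation multiplied by n. *)
Lemma twisted_isotope_elastic (Q : loop) (n : Q) :
  left_bol Q -> right_bol Q -> right_nuclear n ->
  forall a b u v : Q,
    ((u * v) / a) * (b \ ((u * a) * n)) =
    u * (b \ (((b * v) / a) * (b \ ((u * a) * n)))).
Proof.
  intros lb rb nuc a b u v.
  pose proof (bol_elastic _ (isotope_left_bol Q a b lb)
                (isotope_right_bol Q a b rb) (u * a) (b * v)) as E.
  cbn in E; unfold iso_mul in E; rewrite mulrK, mullK in E.
  rewrite (right_nuclear_ldiv Q n nuc), <- (nuc _ (b \ (u * a))), E.
  now rewrite <- (nuc ((b * v) / a)), (right_nuclear_ldiv Q n nuc), nuc.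
Qed.

(** * Inverse property loops *)

Definition inverse_property (Q : loop) : Prop :=
  left_inverse_property Q /\ forall x y : Q, (y * x) * inv x = y.

Lemma mulKinv (Q : loop) :
  inverse_property Q -> forall x y : Q, x * (inv x * y) = y.
Proof.
  intros [lip _] x y.
  now rewrite <- (left_inverse_property_ldiv Q lip), ldivK.
Qed.

Lemma invK (Q : loop) : inverse_property Q -> forall x : Q, inv (inv x) = x.
Proof.
  intros [lip rip] x.
  pose proof (lip (inv x) x) as E; unfold inv at 3 in E.
  now rewrite rdivK, mulx1 in E.
Qed.

Lemma mulinvK (Q : loop) :
  inverse_property Q -> forall x y : Q, (y * inv x) * x = y.
Proof.
  intros ip x y; pose proof (proj2 ip (inv x) y) as E.
  now rewrite (invK Q ip) in E.
Qed.

Lemma inv_mul (Q : loop) :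
  inverse_property Q -> forall x y : Q, inv (x * y) = inv y * inv x.
Proof.
  intros ip x y. apply (mul_cancel_r _ x). rewrite (mulinvK Q ip).
  rewrite <- (proj1 ip (x * y) (inv y)). now rewrite (proj2 ip).
Qed.

(** Let r = p (n^-1 q) = p (q^-1 n)^-1.  Then (r q^-1) n = r (q^-1 n) = p, and
    solving the outer equation for r gives r = (p n^-1) q. *)
Lemma right_nuclear_inv_middle (Q : loop) (n : Q) :
  inverse_property Q -> right_nuclear n ->
  forall p q : Q, (p * inv n) * q = p * (inv n * q).
Proof.
  intros ip nuc p q. apply (mul_cancel_r _ (inv q)).
  rewrite (proj2 ip).
  replace (inv n * q) with (inv (inv q * n))
    by now rewrite (inv_mul Q ip), (invK Q ip).
  apply (mul_cancel_r _ n). rewrite (mulinvK Q ip), nuc.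
  now rewrite (mulinvK Q ip).
Qed.

Lemma right_nuclear_inv (Q : loop) (n : Q) :
  inverse_property Q -> right_nuclear n -> right_nuclear (inv n).
Proof.
  intros ip nuc p q. apply (mul_cancel_r _ n).
  now rewrite (mulinvK Q ip), nuc, (mulinvK Q ip).
Qed.

Lemma right_nuclear_middle (Q : loop) (n : Q) :
  inverse_property Q -> right_nuclear n ->
  forall p q : Q, (p * n) * q = p * (n * q).
Proof.
  intros ip nuc. rewrite <- (invK Q ip n).
  apply right_nuclear_inv_middle, right_nuclear_inv; assumption.
Qed.

(** The map x |-> x^-1 is an antiautomorphism, so it exchanges the two Bol
    identities. *)
Lemma left_bol_right_bol (Q : loop) :
  inverse_property Q -> left_bol Q -> right_bol Q.
Proof.
  intros ip bol x y z.
  pose proof (f_equal inv (bol (inv x) (inv y) (inv z))) as E.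
  now rewrite !(inv_mul Q ip), !(invK Q ip) in E.
Qed.

(** * Companions *)

(** The triple (L_y, R_c, R_c L_y) is an autotopism of Q. *)
Definition companion {Q : loop} (y c : Q) : Prop :=
  forall p q : Q, (y * p) * (q * c) = (y * (p * q)) * c.

Lemma companion_elastic (Q : loop) (y c : Q) :
  companion y c -> forall q : Q, y * (q * c) = (y * q) * c.
Proof.
  intros comp q. pose proof (comp one q) as E.
  now rewrite mulx1, mul1x in E.
Qed.

(** Let W = R_c L_y.  The autotopism gives L_(y t) = W L_t R_c^-1 for all t,
    in particular L_y = W R_c^-1; hence, by the left inverse property,
    L_y L_(y t)^-1 L_y = W L_(t^-1) R_c^-1 = L_(y t^-1).
    The left Bol identity is this one with t = (u y)^-1, where (y t)^-1 = u. *)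
Lemma companion_left_bol (Q : loop) :
  inverse_property Q -> (forall y : Q, exists c, companion y c) -> left_bol Q.
Proof.
  intros ip has_companion y u z.
  destruct (has_companion y) as [c comp].
  rewrite <- (mulinvK Q ip c z). set (s := z * inv c).
  rewrite (companion_elastic _ _ _ comp s), (comp (u * y) s).
  rewrite <- (companion_elastic _ _ _ comp). f_equal.
  pose proof (comp (inv (u * y)) ((u * y) * s)) as E.
  rewrite (proj1 ip) in E.
  rewrite <- E, (inv_mul Q ip), (mulKinv Q ip), (mulKinv Q ip).
  reflexivity.
Qed.

(** The quotient of the two autotopisms is (id, V, V) with
    V q = (q c^-1) d, and such a V is right multiplication by V 1. *)
Lemma companion_quotient_nuclear (Q : loop) (y c d : Q) :
  inverse_property Q -> companion y c -> companion y d ->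
  right_nuclear (inv c * d).
Proof.
  intros ip compc compd.
  assert (V_mul : forall p q : Q,
             p * ((q * inv c) * d) = ((p * q) * inv c) * d).
  { intros p q. rewrite <- (mulKinv Q ip y p). set (t := inv y * p).
    rewrite compd. f_equal. apply (mul_cancel_r _ c).
    now rewrite <- compc, !(mulinvK Q ip). }
  assert (V_translation : forall p : Q, p * (inv c * d) = (p * inv c) * d).
  { intros p. pose proof (V_mul p one) as E. now rewrite mul1x, mulx1 in E. }
  intros p q. now rewrite !V_translation, V_mul.
Qed.

(** The left Bol identity says that (R_y L_y, L_y^-1, L_y) is an autotopism;
    in an inverse property loop (U, V, W) can be replaced by (W, J V J, U),
    where J is the inversion map. *)
Lemma left_bol_companion (Q : loop) :
  inverse_property Q -> left_bol Q -> forall y : Q, companion y y.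
Proof.
  intros ip bol y p q.
  rewrite (bol_elastic Q bol (left_bol_right_bol Q ip bol)).
  apply (mul_cancel_r _ (inv (q * y))). rewrite (proj2 ip).
  rewrite (inv_mul Q ip), bol, (mulKinv Q ip), (proj2 ip). reflexivity.
Qed.

(** Normality of the nucleus: x and n x are both companions of x, since the
    middle nuclear identity absorbs n into the factor before x. *)
Lemma right_nuclear_conjugate (Q : loop) (n x : Q) :
  inverse_property Q -> left_bol Q ->
  right_nuclear n -> right_nuclear (inv x * (n * x)).
Proof.
  intros ip bol nuc.
  pose proof (left_bol_companion Q ip bol x) as comp.
  apply (companion_quotient_nuclear Q x); trivial.
  intros p q. rewrite <- !(right_nuclear_middle Q n ip nuc).
  now rewrite comp, <- !nuc.
Qed.

(** * Generalized Moufang loops *)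

(** Let c = alpha y.  For x = y^-1 the identity reads z c = y^-1 (y (z c)),
    and z c is arbitrary: this is the left inverse property.  By elasticity the
    identity is also ((x y) z) c = x ((y z) c), and z = y^-1 gives the right
    inverse property. *)
Lemma generalized_moufang_inverse_property (Q : loop) (alpha : Q -> Q) :
  generalized_moufang Q alpha -> alpha_elastic Q alpha -> inverse_property Q.
Proof.
  intros moufang elastic.
  assert (lip : left_inverse_property Q).
  { intros y w. rewrite <- (rdivK Q w (alpha y)), <- moufang.
    unfold inv. now rewrite rdivK, mul1x. }
  split; trivial. intros y x.
  assert (y_inv : y * inv y = one).
  { now rewrite <- (mulx1 _ (inv y)), <- (left_inverse_property_ldiv Q lip),
      ldivK. }
  apply (mul_cancel_r _ (alpha y)).
  now rewrite moufang, <- elastic, y_inv, mul1x.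
Qed.

(** Replacing x by t^-1 y^-1 = (y t)^-1 and z by t s turns the identity into
    s c = (y t)^-1 (y ((t s) c)) with c = alpha y; multiplying by y t on the
    left gives the companion law. *)
Lemma alpha_companion (Q : loop) (alpha : Q -> Q) :
  generalized_moufang Q alpha -> alpha_elastic Q alpha ->
  forall y : Q, companion y (alpha y).
Proof.
  intros moufang elastic y t s.
  pose proof (generalized_moufang_inverse_property Q alpha moufang elastic)
    as ip.
  pose proof (moufang (inv t * inv y) y (t * s)) as E.
  rewrite (mulinvK Q ip), (proj1 ip), <- (inv_mul Q ip) in E.
  now rewrite E, (mulKinv Q ip), elastic.
Qed.

Lemma generalized_moufang_left_bol (Q : loop) (alpha : Q -> Q) :
  generalized_moufang Q alpha -> alpha_elastic Q alpha -> left_bol Q.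
Proof.
  intros moufang elastic. apply companion_left_bol.
  - exact (generalized_moufang_inverse_property Q alpha moufang elastic).
  - intros y; exists (alpha y); now apply alpha_companion.
Qed.

(** Comparing the companions y and alpha y of y gives alpha y = y n; the
    factor x is then moved past n by normality of the nucleus. *)
Lemma alpha_mul_nuclear (Q : loop) (alpha : Q -> Q) :
  generalized_moufang Q alpha -> alpha_elastic Q alpha ->
  forall x y : Q, exists n, right_nuclear n /\ alpha y * x = (y * x) * n.
Proof.
  intros moufang elastic x y.
  pose proof (generalized_moufang_inverse_property Q alpha moufang elastic)
    as ip.
  pose proof (generalized_moufang_left_bol Q alpha moufang elastic) as bol.
  set (n := inv y * alpha y).
  assert (n_nuc : right_nuclear n).
  { apply (companion_quotient_nuclear Q y); trivial.
    - now apply left_bol_companion.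
    - now apply alpha_companion. }
  assert (nx_nuc : right_nuclear (inv x * (n * x)))
    by now apply right_nuclear_conjugate.
  exists (inv x * (n * x)); split; trivial.
  rewrite nx_nuc, (mulKinv Q ip), <- (right_nuclear_middle Q n ip n_nuc).
  unfold n; now rewrite (mulKinv Q ip).
Qed.

Theorem theorem3p1 (Q : loop) (alpha : Q -> Q)
    (alpha_onto : Surjective alpha)
    (Q_moufang : generalized_moufang Q alpha)
    (Q_elastic : alpha_elastic Q alpha) :
  universal alpha_elastic Q alpha <->
  (forall x y z b : Q,
     ((y * z) / x) * (b \ (alpha y * x)) =
     y * (b \ (((b * z) / x) * (b \ (alpha y * x)))))
  /\
  (forall x y z b : Q,
     ((((b * y) / x) * (b \ (z * x))) / x) * alpha y =
     ((b * y) / x) * (b \ (z * alpha y))).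
Proof.
  pose proof (generalized_moufang_left_bol Q alpha Q_moufang Q_elastic) as lb.
  pose proof (left_bol_right_bol Q
    (generalized_moufang_inverse_property Q alpha Q_moufang Q_elastic) lb)
    as rb.
  pose proof (alpha_mul_nuclear Q alpha Q_moufang Q_elastic) as alpha_mul.
  assert (alpha_nuc : forall y : Q,
             exists n, right_nuclear n /\ alpha y = y * n).
  { intros y. destruct (alpha_mul one y) as [n [nuc E]].
    exists n; split; trivial. now rewrite !mulx1 in E. }
  split; intros _; split.
  - intros x y z b. destruct (alpha_mul x y) as [n [nuc ->]].
    now apply twisted_isotope_elastic.
  - intros x y z b. destruct (alpha_nuc y) as [n [nuc ->]].
    pose proof (twisted_isotope_elastic Q n lb rb nuc x b
                  ((b * y) / x) (b \ (z * x))) as E.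
    now rewrite rdivK, (right_nuclear_ldiv Q n nuc), mullK, ldivK, mulrK in E.
  - exact Q_elastic.
  - intros a b y z; cbn in y, z |- *; unfold iso_mul.
    destruct (alpha_nuc y) as [n [nuc ->]].
    pose proof (twisted_isotope_elastic Q n lb rb nuc a b (y / a) (b \ z)) as E.
    now rewrite rdivK, ldivK in E.
Qed.
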